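(* There exists $T\in[0,b]$, where $b\approx 0.13504$ is the largest value of $T$ for which the Harborth configuration exists, such that the Harborth configuration with parameter $T$ exists and satisfies $\varphi=90^\circ$ exactly, i.e. the line $HJ$ is perpendicular to the line $AC$; for this $T$ the configuration can be completed to the Harborth graph.
   Context: Harborth configuration. For a parameter $T$ with $0\le T\le 1$ put $t=\sqrt{1-T^2}$ and define points of $\mathbb R^2$: $A=(0,0)$, $B=(t,T)$, $C=(2t,0)$, $D=\big(\tfrac12(3\sqrt3\,T+t),\ \tfrac32(T+\sqrt3\,t)\big)$, $E=(\sqrt3\,T,\ 2T+\sqrt3\,t)$. Thus $ABC$ is isosceles with $|AB|=|BC|=1$ and height $T$, and $BCDE$ is a symmetric trapezoid with $|BC|=|DE|=1$, $|BE|=2$, $|CD|=3$. Further: $F$ is the point with $|FA|=|FE|=1$ lying on the opposite side of the line $AE$ from $B$ (so that $ABEF$ is convex); $G$ is the point with $|GF|=1$, $|GD|=2$ lying to the left of the directed line from $F$ to $D$; $H$ is the point with $|HD|=|HG|=2$ lying to the left of the directed line from $G$ to $D$; $J$ is the point with $|JF|=|JG|=1$ lying to the right of the directed line from $G$ to $F$. The configuration is said to exist for $T$ if all these circle intersections exist as real points. Let $\varphi$ be the angle measured counterclockwise from the positive $x$-axis (the direction of $AC$) to the vector $H-J$. The Harborth graph is the known 4-regular planar unit-distance graph; the points $A,\dots,J$ describe one quarter of it, and the whole graph is obtained from the configuration by reflecting in the line $AC$ and in the line $HJ$, which is possible precisely when $\varphi=90^\circ$. *)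

(* Defs.v *)
From Stdlib Require Import Reals Lra List Bool Arith.
Import ListNotations.
Open Scope R_scope.

Definition point := (R * R)%type.

Definition vec (P Q : point) : point := (fst Q - fst P, snd Q - snd P).
Definition dot (u v : point) : R := fst u * fst v + snd u * snd v.
Definition cross (u v : point) : R := fst u * snd v - snd u * fst v.
Definition dist (P Q : point) : R := dist_euc (fst P) (snd P) (fst Q) (snd Q).

(** The side conditions are weak on purpose.  When the two circles being
    intersected are tangent, their only common point lies on the line of
    centres and has to be accepted; when they meet in two points, these lie
    strictly on different sides, so the weak condition still selects one. *)
Definition on_left (P Q X : point) : Prop := 0 <= cross (vec P Q) (vec P X).
Definition on_right (P Q X : point) : Prop := cross (vec P Q) (vec P X) <= 0.
Definition opposite_sides (P Q X Y : point) : Prop :=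
  cross (vec P Q) (vec P X) * cross (vec P Q) (vec P Y) <= 0.

Definition in_segment (P Q X : point) : Prop :=
  exists s, 0 <= s <= 1 /\
    X = ((1 - s) * fst P + s * fst Q, (1 - s) * snd P + s * snd Q).

(** Reflection in the line through [P] and [Q] (meaningful for [P <> Q]):
    [X] goes to [2 * proj X - X], [proj] being the orthogonal projection. *)
Definition reflect (P Q X : point) : point :=
  let d := vec P Q in
  let s := dot (vec P X) d / dot d d in
  (2 * (fst P + s * fst d) - fst X, 2 * (snd P + s * snd d) - snd X).

Definition polar_angle (v : point) (phi : R) : Prop :=
  0 <= phi < 2 * PI /\
  exists r, 0 < r /\ v = (r * cos phi, r * sin phi).

Record configuration := Configuration {
  pA : point; pB : point; pC : point; pD : point; pE : point;
  pF : point; pG : point; pH : point; pJ : point }.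

Definition is_harborth_configuration (T : R) (c : configuration) : Prop :=
  let t := sqrt (1 - T ^ 2) in
  0 <= T <= 1 /\
  pA c = (0, 0) /\
  pB c = (t, T) /\
  pC c = (2 * t, 0) /\
  pD c = (/ 2 * (3 * sqrt 3 * T + t), 3 / 2 * (T + sqrt 3 * t)) /\
  pE c = (sqrt 3 * T, 2 * T + sqrt 3 * t) /\
  (dist (pF c) (pA c) = 1 /\ dist (pF c) (pE c) = 1 /\
     opposite_sides (pA c) (pE c) (pB c) (pF c)) /\
  (dist (pG c) (pF c) = 1 /\ dist (pG c) (pD c) = 2 /\
     on_left (pF c) (pD c) (pG c)) /\
  (dist (pH c) (pD c) = 2 /\ dist (pH c) (pG c) = 2 /\
     on_left (pG c) (pD c) (pH c)) /\
  (dist (pJ c) (pF c) = 1 /\ dist (pJ c) (pG c) = 1 /\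
     on_right (pG c) (pF c) (pJ c)).

Definition configuration_exists (T : R) : Prop :=
  exists c, is_harborth_configuration T c.

Definition largest_parameter (b : R) : Prop :=
  configuration_exists b /\ forall T, configuration_exists T -> T <= b.

(** One quarter of the graph.  Sides of length 2 or 3 are subdivided into unit
    edges: [CD] by [C1], [C2] and [BE] by [B1], so that the trapezoid [BCDE]
    consists of five unit triangles; the sides of the triangle [DGH] by their
    midpoints, so that it consists of four.  The vertices [A], [C] lie on the
    first mirror line and [H], [J] on the second one. *)
Inductive mirror1_vertex := vA | vC.
Inductive mirror2_vertex := vH | vJ.
Inductive free_vertex :=
  vB | vD | vE | vF | vG | vB1 | vC1 | vC2 | vDG | vDH | vGH.

Inductive quarter_vertex :=
  | OnMirror1 (x : mirror1_vertex)
  | OnMirror2 (x : mirror2_vertex)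
  | Free (x : free_vertex).

Definition quarter_edges : list (quarter_vertex * quarter_vertex) :=
  let A := OnMirror1 vA in let C := OnMirror1 vC in
  let H := OnMirror2 vH in let J := OnMirror2 vJ in
  let B := Free vB in let D := Free vD in let E := Free vE in
  let F := Free vF in let G := Free vG in
  let B1 := Free vB1 in let C1 := Free vC1 in let C2 := Free vC2 in
  let DG := Free vDG in let DH := Free vDH in let GH := Free vGH in
  [ (A, B);
    (B, C); (C, C1); (C1, C2); (C2, D); (B, B1); (B1, E); (D, E);
    (B, C1); (C1, B1); (B1, C2); (C2, E);
    (F, A); (F, E); (G, F);
    (D, DG); (DG, G); (D, DH); (DH, H); (G, GH); (GH, H);
    (DG, DH); (DH, GH); (GH, DG);
    (J, F); (J, G) ].

(** The graph is glued from four copies of the quarter, indexed by two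
    booleans which say whether the copy is reflected in the first and in the
    second mirror line.  A vertex on a mirror line is shared by the two copies
    which that reflection exchanges. *)
Inductive harborth_vertex :=
  | HMirror1 (x : mirror1_vertex) (r2 : bool)
  | HMirror2 (x : mirror2_vertex) (r1 : bool)
  | HFree (x : free_vertex) (r1 r2 : bool).

Definition copy (r1 r2 : bool) (q : quarter_vertex) : harborth_vertex :=
  match q with
  | OnMirror1 x => HMirror1 x r2
  | OnMirror2 x => HMirror2 x r1
  | Free x => HFree x r1 r2
  end.

Definition harborth_edges : list (harborth_vertex * harborth_vertex) :=
  flat_map (fun r : bool * bool =>
    map (fun e : quarter_vertex * quarter_vertex =>
           (copy (fst r) (snd r) (fst e), copy (fst r) (snd r) (snd e)))
        quarter_edges)
    [(false, false); (true, false); (false, true); (true, true)].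

Definition harborth_vertex_eq_dec (x y : harborth_vertex) : {x = y} + {x <> y}.
Proof. repeat decide equality. Defined.

Definition harborth_vertices : list harborth_vertex :=
  flat_map (fun x => map (HMirror1 x) [false; true]) [vA; vC] ++
  flat_map (fun x => map (HMirror2 x) [false; true]) [vH; vJ] ++
  flat_map (fun x =>
    flat_map (fun r1 => map (HFree x r1) [false; true]) [false; true])
    [vB; vD; vE; vF; vG; vB1; vC1; vC2; vDG; vDH; vGH].

Definition incident (x : harborth_vertex)
    (e : harborth_vertex * harborth_vertex) : bool :=
  (if harborth_vertex_eq_dec x (fst e) then true else false)
  || (if harborth_vertex_eq_dec x (snd e) then true else false).

Lemma harborth_vertices_complete (x : harborth_vertex) :
  In x harborth_vertices.
Proof.
destruct x as [x r2 | x r1 | x r1 r2]; destruct x;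
  try destruct r1; try destruct r2; vm_compute; tauto.
Qed.

Lemma harborth_vertices_card :
  NoDup harborth_vertices /\ length harborth_vertices = 52%nat.
Proof.
split; [|reflexivity].
apply (NoDup_count_occ' harborth_vertex_eq_dec); apply Forall_forall.
repeat (constructor; [vm_compute; reflexivity|]); constructor.
Qed.

Lemma harborth_edges_card : length harborth_edges = 104%nat.
Proof. reflexivity. Qed.

Lemma harborth_edges_simple :
  ForallOrdPairs (fun e f => e <> f /\ e <> (snd f, fst f)) harborth_edges /\
  Forall (fun e => fst e <> snd e) harborth_edges.
Proof.
split; unfold harborth_edges; cbn -[not];
  repeat constructor; cbn; intro H; discriminate H.
Qed.

Lemma harborth_graph_4_regular (x : harborth_vertex) :
  length (filter (incident x) harborth_edges) = 4%nat.
Proof.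
destruct x as [x r2 | x r1 | x r1 r2]; destruct x;
  try destruct r1; try destruct r2; reflexivity.
Qed.

(** Plane drawing with straight edges of length 1: two different edges meet at
    most in the images of common endpoints. *)
Definition planar_unit_distance_drawing {V : Type} (edges : list (V * V))
    (place : V -> point) : Prop :=
  (forall x y, place x = place y -> x = y) /\
  (forall x y, In (x, y) edges -> dist (place x) (place y) = 1) /\
  (forall x y u v p,
     In (x, y) edges -> In (u, v) edges -> (x, y) <> (u, v) ->
     in_segment (place x) (place y) p -> in_segment (place u) (place v) p ->
     exists w, (w = x \/ w = y) /\ (w = u \/ w = v) /\ p = place w).

Definition subdivide (P Q : point) (s : R) : point :=
  (fst P + s * (fst Q - fst P), snd P + s * (snd Q - snd P)).

Definition quarter_position (c : configuration) (q : quarter_vertex) : point :=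
  match q with
  | OnMirror1 vA => pA c
  | OnMirror1 vC => pC c
  | OnMirror2 vH => pH c
  | OnMirror2 vJ => pJ c
  | Free vB => pB c
  | Free vD => pD c
  | Free vE => pE c
  | Free vF => pF c
  | Free vG => pG c
  | Free vB1 => subdivide (pB c) (pE c) (1 / 2)
  | Free vC1 => subdivide (pC c) (pD c) (1 / 3)
  | Free vC2 => subdivide (pC c) (pD c) (2 / 3)
  | Free vDG => subdivide (pD c) (pG c) (1 / 2)
  | Free vDH => subdivide (pD c) (pH c) (1 / 2)
  | Free vGH => subdivide (pG c) (pH c) (1 / 2)
  end.

(** The four images of the quarter under reflection in the lines [AC] and [HJ]
    fit together to a plane unit-distance drawing of the Harborth graph.  That
    [place] is well defined on the vertices shared by two copies includes that
    reflecting in [AC] and reflecting in [HJ] are compatible there. *)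
Definition completes_to_harborth_graph (c : configuration) : Prop :=
  exists place : harborth_vertex -> point,
    (forall (r1 r2 : bool) (q : quarter_vertex),
       let P := quarter_position c q in
       let P' := if r2 then reflect (pH c) (pJ c) P else P in
       let P'' := if r1 then reflect (pA c) (pC c) P' else P' in
       place (copy r1 r2 q) = P'') /\
    planar_unit_distance_drawing harborth_edges place.

(* Main.v *)
From Stdlib Require Import Reals Lra Lia ZArith List Bool Ranalysis5.
Require Import Defs.
Import ListNotations.
Open Scope R_scope.

(** The point [F] exists exactly when [|AE| <= 2], where
    [|AE|^2 = 3 + 4 T^2 + 4 sqrt 3 T t]; this is a quartic condition on [T] and
    gives [b = sqrt 2 (3 - sqrt 5) / 8], at which [F] is the midpoint of [AE].
    The abscissa of [H - J] depends continuously on [T] and changes sign between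
    0.12072 and 0.12073, so it vanishes at some [T] there.  Enclosures of the
    points over this short interval show that the quarter is drawn without
    crossings and that it lies in the quadrant bounded by the lines [AC] and [HJ],
    touching [AC] only in [A], [C] and [HJ] only in [H], [J].  Hence its mirror
    images can only meet in these points. *)

(** * Fixed-point interval arithmetic *)

(** The solution is only given by a sign change, so computation can confirm nothing about it but
    strict inequalities. The exact parts of the claim stay outside the computation: unit lengths are
    polynomial identities, the ordinates of [A] and [C] vanish by definition, and equal abscissae of
    [H] and [J] are the root condition itself. Pairs of edges for which a separation test
    degenerates, because they share a vertex or lie on one line, get criteria of their own. The
    value [b] is out of reach of the enclosures too: there the circles about [A] and [E] are tangent
    and the square root has argument 0, so [b] is treated by exact algebra. All boxes are functions
    of the parameter interval, so that one construction serves both for the whole interval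
    (continuity, planarity) and for its end points (signs). *)

Definition itv := (Z * Z)%type.
Definition scale : Z := 1000000000%Z.

(* The pair of integers [(l, u)] stands for the interval [[l / scale, u / scale]]. *)
Definition mem (J : itv) (x : R) : Prop :=
  IZR (fst J) <= x * IZR scale <= IZR (snd J).

Definition cdiv (m n : Z) : Z := (- (- m / n))%Z.

Definition icst (n : Z) : itv := (n * scale, n * scale)%Z.
Definition iadd (I J : itv) : itv := (fst I + fst J, snd I + snd J)%Z.
Definition iopp (I : itv) : itv := (- snd I, - fst I)%Z.
Definition isub (I J : itv) : itv := iadd I (iopp J).
(** Products of numerators have denominator [scale * scale]; one division, rounded outward, restores
    the common denominator. *)
Definition imul (I J : itv) : itv :=
  let p := (fst I * fst J)%Z in let q := (fst I * snd J)%Z in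
  let r := (snd I * fst J)%Z in let s := (snd I * snd J)%Z in
  (Z.min (Z.min p q) (Z.min r s) / scale,
   cdiv (Z.max (Z.max p q) (Z.max r s)) scale)%Z.
Definition iinv (I : itv) : itv :=
  (scale * scale / snd I, cdiv (scale * scale) (fst I))%Z.
(** The root of [k / scale] has numerator [sqrt (k * scale)]. [Z.sqrt] rounds down, hence the [+ 1]
    in the upper bound. *)
Definition isqrt (I : itv) : itv :=
  (Z.sqrt (fst I * scale), Z.sqrt (snd I * scale) + 1)%Z.
Definition ipos (I : itv) : bool := (0 <? fst I)%Z.

Lemma scale_pos : 0 < IZR scale.
Proof. apply IZR_lt; reflexivity. Qed.

Lemma IZR_div_le (m n : Z) : (0 < n)%Z -> IZR (m / n) <= IZR m / IZR n.
Proof.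
intros Hn; assert (H := IZR_lt _ _ Hn).
apply Rmult_le_reg_r with (IZR n); [lra|].
unfold Rdiv; rewrite Rmult_assoc, Rinv_l, Rmult_1_r by lra.
rewrite <- mult_IZR; apply IZR_le; rewrite Z.mul_comm.
now apply Z.mul_div_le.
Qed.

Lemma IZR_cdiv_ge (m n : Z) : (0 < n)%Z -> IZR m / IZR n <= IZR (cdiv m n).
Proof.
intros Hn; unfold cdiv; rewrite opp_IZR.
assert (H := IZR_div_le (- m) n Hn); rewrite opp_IZR in H.
unfold Rdiv in *; lra.
Qed.

Lemma ipos_spec (I : itv) (x : R) : ipos I = true -> mem I x -> 0 < x.
Proof.
intros H [Hx _]; apply Z.ltb_lt, IZR_lt in H.
assert (S := scale_pos); nra.
Qed.

Lemma mem_icst (n : Z) : mem (icst n) (IZR n).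
Proof. unfold mem, icst; cbn [fst snd]; rewrite mult_IZR; lra. Qed.

Lemma mem_iadd (I J : itv) (x y : R) :
  mem I x -> mem J y -> mem (iadd I J) (x + y).
Proof. unfold mem, iadd; cbn [fst snd]; rewrite !plus_IZR; lra. Qed.

Lemma mem_iopp (I : itv) (x : R) : mem I x -> mem (iopp I) (- x).
Proof. unfold mem, iopp; cbn [fst snd]; rewrite !opp_IZR; lra. Qed.

Lemma mem_isub (I J : itv) (x y : R) :
  mem I x -> mem J y -> mem (isub I J) (x - y).
Proof. intros Hx Hy; apply mem_iadd; [assumption | now apply mem_iopp]. Qed.

(** A bilinear function on a rectangle attains its minimum at a corner. The upper bound needed for
    [imul] follows by applying this to [- x]. *)
Lemma mult_ge_corner (a b c d x y m : R) :
  a <= x <= b -> c <= y <= d ->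
  m <= a * c -> m <= a * d -> m <= b * c -> m <= b * d -> m <= x * y.
Proof.
intros Hx Hy H1 H2 H3 H4.
destruct (Rle_lt_dec 0 y); [destruct (Rle_lt_dec 0 a) | destruct (Rle_lt_dec 0 b)];
  nra.
Qed.

Lemma mem_imul (I J : itv) (x y : R) :
  mem I x -> mem J y -> mem (imul I J) (x * y).
Proof.
assert (S := scale_pos).
assert (Sz : (0 < scale)%Z) by reflexivity.
intros Hx Hy; unfold mem in *; unfold imul; cbn [fst snd].
set (X := x * IZR scale) in *; set (Y := y * IZR scale) in *.
replace (x * y * IZR scale) with (X * Y / IZR scale)
  by (unfold X, Y; field; lra).
assert (D : forall u v, u <= v -> u / IZR scale <= v / IZR scale).
{ intros u v H; apply Rmult_le_compat_r; [|assumption].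
  left; now apply Rinv_0_lt_compat. }
split.
- eapply Rle_trans; [now apply IZR_div_le|]; apply D.
  apply (mult_ge_corner _ _ _ _ _ _ _ Hx Hy); rewrite <- mult_IZR;
    apply IZR_le; lia.
- eapply Rle_trans; [|now apply IZR_cdiv_ge]; apply D.
  apply Ropp_le_cancel; rewrite Ropp_mult_distr_l.
  assert (Hx' : - IZR (snd I) <= - X <= - IZR (fst I)) by lra.
  apply (mult_ge_corner _ _ _ _ _ _ _ Hx' Hy); rewrite <- Ropp_mult_distr_l;
    apply Ropp_le_contravar; rewrite <- mult_IZR; apply IZR_le; lia.
Qed.

Lemma mem_iinv (I : itv) (x : R) :
  ipos I = true -> mem I x -> mem (iinv I) (/ x).
Proof.
intros HI Hx; assert (H0 := ipos_spec I x HI Hx).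
assert (S := scale_pos); apply Z.ltb_lt in HI.
assert (HI' := IZR_lt _ _ HI); unfold mem in *; unfold iinv; cbn [fst snd].
assert (Hs : 0 < IZR (snd I)) by lra.
apply lt_IZR in Hs.
assert (E : / x * IZR scale = IZR scale * IZR scale / (x * IZR scale))
  by (field; lra).
rewrite E; split.
- eapply Rle_trans; [now apply IZR_div_le|]; rewrite mult_IZR.
  apply Rmult_le_compat_l; [nra|]; apply Rinv_le_contravar; nra.
- eapply Rle_trans; [|now apply IZR_cdiv_ge]; rewrite mult_IZR.
  apply Rmult_le_compat_l; [nra|]; apply Rinv_le_contravar; lra.
Qed.

Lemma mem_isqrt (I : itv) (x : R) :
  ipos I = true -> mem I x -> mem (isqrt I) (sqrt x).
Proof.
intros HI Hx; assert (H0 := ipos_spec I x HI Hx).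
assert (S := scale_pos); apply Z.ltb_lt in HI.
assert (Sz : (0 < scale)%Z) by reflexivity.
assert (HI' := IZR_lt _ _ HI); unfold mem in *; unfold isqrt; cbn [fst snd].
assert (Hs : 0 < IZR (snd I)) by lra.
apply lt_IZR in Hs.
assert (E : sqrt x * IZR scale = sqrt (x * IZR scale * IZR scale)).
{ rewrite Rmult_assoc, sqrt_mult, sqrt_square by nra; reflexivity. }
assert (P : forall k : Z, (0 <= k)%Z -> sqrt (IZR k * IZR k) = IZR k).
{ intros k Hk; apply sqrt_square; now apply IZR_le. }
rewrite E; split.
- assert (L := Z.sqrt_spec (fst I * scale) ltac:(nia)); cbv zeta in L.
  rewrite <- (P (Z.sqrt (fst I * scale))) by apply Z.sqrt_nonneg; apply sqrt_le_1_alt.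
  rewrite <- mult_IZR.
  apply Rle_trans with (IZR (fst I * scale)); [apply IZR_le; lia|].
  rewrite mult_IZR; nra.
- assert (L := Z.sqrt_spec (snd I * scale) ltac:(nia)); cbv zeta in L.
  assert (N := Z.sqrt_nonneg (snd I * scale)).
  rewrite <- (P (Z.sqrt (snd I * scale) + 1)%Z) by lia; apply sqrt_le_1_alt.
  rewrite <- mult_IZR.
  apply Rle_trans with (IZR (snd I * scale)); [|apply IZR_le; lia].
  rewrite mult_IZR; nra.
Qed.

(** Continuity is bundled with the enclosure because both depend on the same side conditions:
    positivity of the arguments of inverses and square roots. The intermediate value theorem then
    needs no separate continuity proof. *)
Definition encl (I : itv) (f : R -> R) (J : itv) : Prop :=
  forall x, mem I x -> mem J (f x) /\ continuity_pt f x.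

Section Enclosures.

Variable I : itv.

Lemma encl_id : encl I (fun x => x) I.
Proof.
intros x Hx; split; [assumption|].
apply derivable_continuous_pt, derivable_pt_id.
Qed.

Lemma encl_icst (n : Z) : encl I (fun _ => IZR n) (icst n).
Proof.
intros x _; split; [apply mem_icst|].
apply continuity_pt_const; now intros u v.
Qed.

Lemma encl_iadd (f g : R -> R) (J K : itv) :
  encl I f J -> encl I g K -> encl I (fun x => f x + g x) (iadd J K).
Proof.
intros Hf Hg x Hx; destruct (Hf x Hx), (Hg x Hx); split.
- now apply mem_iadd.
- now apply (continuity_pt_plus f g).
Qed.

Lemma encl_iopp (f : R -> R) (J : itv) :
  encl I f J -> encl I (fun x => - f x) (iopp J).
Proof.
intros Hf x Hx; destruct (Hf x Hx); split.
- now apply mem_iopp.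
- now apply (continuity_pt_opp f).
Qed.

Lemma encl_isub (f g : R -> R) (J K : itv) :
  encl I f J -> encl I g K -> encl I (fun x => f x - g x) (isub J K).
Proof.
intros Hf Hg; apply (encl_iadd f (fun x => - g x)); [assumption|].
now apply encl_iopp.
Qed.

Lemma encl_imul (f g : R -> R) (J K : itv) :
  encl I f J -> encl I g K -> encl I (fun x => f x * g x) (imul J K).
Proof.
intros Hf Hg x Hx; destruct (Hf x Hx), (Hg x Hx); split.
- now apply mem_imul.
- now apply (continuity_pt_mult f g).
Qed.

Lemma encl_iinv (f : R -> R) (J : itv) :
  ipos J = true -> encl I f J -> encl I (fun x => / f x) (iinv J).
Proof.
intros HJ Hf x Hx; destruct (Hf x Hx) as [Hm Hc]; split.
- now apply mem_iinv.
- apply (continuity_pt_inv f); [assumption|].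
  apply Rgt_not_eq; exact (ipos_spec J (f x) HJ Hm).
Qed.

Lemma encl_isqrt (f : R -> R) (J : itv) :
  ipos J = true -> encl I f J -> encl I (fun x => sqrt (f x)) (isqrt J).
Proof.
intros HJ Hf x Hx; destruct (Hf x Hx) as [Hm Hc]; split.
- now apply mem_isqrt.
- apply (continuity_pt_comp f sqrt); [assumption|].
  apply continuity_pt_sqrt; left; exact (ipos_spec J (f x) HJ Hm).
Qed.

End Enclosures.

(** The recursion follows the interval expression and leaves the function to unification. Interval
    definitions therefore have to mirror the real expressions operation by operation. Hypotheses
    supply subexpressions that are already enclosed. *)
Ltac enclose :=
  lazymatch goal with
  | |- encl _ _ (icst _) => apply encl_icst
  | |- encl _ _ (iadd _ _) => apply encl_iadd; enclose
  | |- encl _ _ (isub _ _) => apply encl_isub; enclose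
  | |- encl _ _ (iopp _) => apply encl_iopp; enclose
  | |- encl _ _ (imul _ _) => apply encl_imul; enclose
  | |- encl _ _ (iinv _) => apply encl_iinv; [first [assumption | reflexivity] | enclose]
  | |- encl _ _ (isqrt _) => apply encl_isqrt; [first [assumption | reflexivity] | enclose]
  | _ => first [assumption | apply encl_id]
  end.

(** * Intersection of two circles *)

(** With [q] the squared distance of the centres, this is the position of the foot of the
    perpendicular from the common point, as a fraction of the segment between them. [apex_disc] is
    the squared height divided by [q]. Measuring in units of that segment avoids the square root of
    [q]. *)
Definition apex_foot (q r1 r2 : R) : R := / 2 * (1 + (r1 * r1 - r2 * r2) * / q).
Definition apex_disc (q r1 r2 : R) : R :=
  r1 * r1 * / q - apex_foot q r1 r2 * apex_foot q r1 r2.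
Definition sqdist (P Q : point) : R := dot (vec P Q) (vec P Q).

(* The common point, to the left of [PQ], of the circles of radius [r1] about [P]
   and of radius [r2] about [Q]; they meet when [apex_disc] is nonnegative. *)
Definition apex (P Q : point) (r1 r2 : R) : point :=
  let q := sqdist P Q in
  let a := apex_foot q r1 r2 in
  let s := sqrt (apex_disc q r1 r2) in
  let d := vec P Q in
  (fst P + (a * fst d - s * snd d), snd P + (a * snd d + s * fst d)).

Lemma dist_of_sqdist (P Q : point) (r : R) :
  0 <= r -> sqdist P Q = r * r -> dist P Q = r.
Proof.
intros Hr H; unfold dist, dist_euc, sqdist, dot, vec, Rsqr in *; cbn [fst snd] in *.
rewrite <- (sqrt_square r Hr); f_equal; lra.
Qed.

Lemma sqdist_of_dist (P Q : point) (r : R) : dist P Q = r -> sqdist P Q = r * r.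
Proof.
intros <-; unfold dist, dist_euc, sqdist, dot, vec, Rsqr in *; cbn [fst snd] in *.
rewrite sqrt_sqrt; [lra | apply Rplus_le_le_0_compat; apply Rle_0_sqr].
Qed.

Lemma apex_spec (P Q : point) (r1 r2 : R) :
  0 <= r1 -> 0 <= r2 -> 0 < sqdist P Q -> 0 <= apex_disc (sqdist P Q) r1 r2 ->
  dist (apex P Q r1 r2) P = r1 /\ dist (apex P Q r1 r2) Q = r2 /\
  on_left P Q (apex P Q r1 r2).
Proof.
intros H1 H2 Hq Hd.
assert (S := sqrt_sqrt _ Hd); assert (S0 := sqrt_pos (apex_disc (sqdist P Q) r1 r2)).
(* Cleared of denominators, the definitions of foot and height become two polynomial relations,
   which give both distances; the cross product is [s] times the squared distance of the centres. *)
assert (Ha : 2 * apex_foot (sqdist P Q) r1 r2 * sqdist P Q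
             = sqdist P Q + r1 * r1 - r2 * r2)
  by (unfold apex_foot; field; lra).
assert (Hd' : apex_disc (sqdist P Q) r1 r2 * sqdist P Q =
  r1 * r1 - apex_foot (sqdist P Q) r1 r2 * apex_foot (sqdist P Q) r1 r2 * sqdist P Q)
  by (unfold apex_disc; field; lra).
rewrite <- S in Hd'; unfold apex; cbv zeta.
set (s := sqrt _) in *; set (a := apex_foot _ _ _) in *; clearbody s a.
repeat split; try apply dist_of_sqdist; try assumption;
  unfold on_left, cross; unfold sqdist, dot, vec in *; cbn [fst snd] in *;
  destruct P as [px py], Q as [qx qy]; cbn [fst snd] in *; clear S; nra.
Qed.

(** * Boxes around points and the enclosure of circle intersections *)

Definition box := (itv * itv)%type.
Definition memp (B : box) (P : point) : Prop := mem (fst B) (fst P) /\ mem (snd B) (snd P).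
Definition enclp (I : itv) (P : R -> point) (B : box) : Prop :=
  encl I (fun T => fst (P T)) (fst B) /\ encl I (fun T => snd (P T)) (snd B).

Definition ivec (B C : box) : box := (isub (fst C) (fst B), isub (snd C) (snd B)).
Definition idot (B C : box) : itv :=
  iadd (imul (fst B) (fst C)) (imul (snd B) (snd C)).
Definition icross (B C : box) : itv :=
  isub (imul (fst B) (snd C)) (imul (snd B) (fst C)).

Definition ifoot (q : itv) (r1 r2 : Z) : itv :=
  imul (iinv (icst 2)) (iadd (icst 1)
    (imul (isub (imul (icst r1) (icst r1)) (imul (icst r2) (icst r2))) (iinv q))).
Definition idisc (q : itv) (r1 r2 : Z) : itv :=
  isub (imul (imul (icst r1) (icst r1)) (iinv q)) (imul (ifoot q r1 r2) (ifoot q r1 r2)).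
Definition isqdist (B C : box) : itv := idot (ivec B C) (ivec B C).

Definition apex_box (B C : box) (r1 r2 : Z) : box :=
  let q := isqdist B C in
  let a := ifoot q r1 r2 in
  let s := isqrt (idisc q r1 r2) in
  let d := ivec B C in
  (iadd (fst B) (isub (imul a (fst d)) (imul s (snd d))),
   iadd (snd B) (iadd (imul a (snd d)) (imul s (fst d)))).
Definition apex_ok (B C : box) (r1 r2 : Z) : bool :=
  ipos (isqdist B C) && ipos (idisc (isqdist B C) r1 r2).

Lemma enclp_apex (I : itv) (P Q : R -> point) (B C : box) (r1 r2 : Z) :
  enclp I P B -> enclp I Q C -> apex_ok B C r1 r2 = true ->
  enclp I (fun T => apex (P T) (Q T) (IZR r1) (IZR r2)) (apex_box B C r1 r2) /\
  forall T, mem I T -> 0 < sqdist (P T) (Q T) /\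
    0 < apex_disc (sqdist (P T) (Q T)) (IZR r1) (IZR r2).
Proof.
intros [P1 P2] [Q1 Q2] H; apply andb_prop in H; destruct H as [Hq Hd].
assert (D1 : encl I (fun T => fst (vec (P T) (Q T))) (fst (ivec B C)))
  by (cbn [fst snd vec ivec]; enclose).
assert (D2 : encl I (fun T => snd (vec (P T) (Q T))) (snd (ivec B C)))
  by (cbn [fst snd vec ivec]; enclose).
assert (Eq : encl I (fun T => sqdist (P T) (Q T)) (isqdist B C))
  by (unfold sqdist, isqdist, dot, idot; enclose).
assert (Ea : encl I (fun T => apex_foot (sqdist (P T) (Q T)) (IZR r1) (IZR r2))
               (ifoot (isqdist B C) r1 r2))
  by (unfold apex_foot, ifoot; enclose).
assert (Ed : encl I (fun T => apex_disc (sqdist (P T) (Q T)) (IZR r1) (IZR r2))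
               (idisc (isqdist B C) r1 r2))
  by (unfold apex_disc, idisc; enclose).
split.
- split; unfold apex, apex_box; cbv zeta; cbn [fst snd]; enclose.
- intros T HT; split.
  + exact (ipos_spec _ _ Hq (proj1 (Eq T HT))).
  + exact (ipos_spec _ _ Hd (proj1 (Ed T HT))).
Qed.

(** * The configuration as a function of the parameter *)

Definition leg (T : R) : R := sqrt (1 - T ^ 2).
Definition ptA (T : R) : point := (0, 0).
Definition ptB (T : R) : point := (leg T, T).
Definition ptC (T : R) : point := (2 * leg T, 0).
Definition ptD (T : R) : point :=
  (/ 2 * (3 * sqrt 3 * T + leg T), 3 / 2 * (T + sqrt 3 * leg T)).
Definition ptE (T : R) : point := (sqrt 3 * T, 2 * T + sqrt 3 * leg T).
(** [apex] always takes the left side. For [F] this is correct because [B] lies to the right of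
    [AE]; for [J], the right of [GF] is the left of [FG]. *)
Definition ptF (T : R) : point := apex (ptA T) (ptE T) 1 1.
Definition ptG (T : R) : point := apex (ptF T) (ptD T) 1 2.
Definition ptH (T : R) : point := apex (ptG T) (ptD T) 2 2.
Definition ptJ (T : R) : point := apex (ptF T) (ptG T) 1 1.

Definition harborth (T : R) : configuration :=
  {| pA := ptA T; pB := ptB T; pC := ptC T; pD := ptD T; pE := ptE T;
     pF := ptF T; pG := ptG T; pH := ptH T; pJ := ptJ T |}.

Lemma leg_sqr (T : R) : 0 <= T <= 1 -> leg T * leg T = 1 - T * T.
Proof. intros H; unfold leg; rewrite sqrt_sqrt; nra. Qed.

Lemma leg_nonneg (T : R) : 0 <= leg T.
Proof. apply sqrt_pos. Qed.

Lemma sqrt3_sqr : sqrt 3 * sqrt 3 = 3.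
Proof. apply sqrt_sqrt; lra. Qed.

Lemma sqrt3_bounds : 1.7 < sqrt 3 < 1.8.
Proof.
assert (S := sqrt3_sqr); assert (P := sqrt_pos 3); split; nra.
Qed.

Lemma sqdist_AE (T : R) :
  0 <= T <= 1 -> sqdist (ptA T) (ptE T) = 3 + 4 * T * T + 4 * sqrt 3 * T * leg T.
Proof.
intros H; assert (L := leg_sqr T H); assert (S := sqrt3_sqr).
unfold sqdist, dot, vec; cbn [fst snd ptA ptE]; nra.
Qed.

Lemma apex_disc_isosceles (q : R) : 0 < q <= 4 -> 0 <= apex_disc q 1 1.
Proof.
intros H; replace (apex_disc q 1 1) with ((4 - q) * / (4 * q))
  by (unfold apex_disc, apex_foot; field; lra).
apply Rmult_le_pos; [lra | left; apply Rinv_0_lt_compat; lra].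
Qed.

(** Heron's factorisation: circles of radii 1 and 2 meet when their centres are between 1 and 3
    apart. *)
Lemma apex_disc_1_2 (q : R) : 1 <= q <= 9 -> 0 <= apex_disc q 1 2.
Proof.
intros H; replace (apex_disc q 1 2) with ((9 - q) * (q - 1) * / (4 * q * q))
  by (unfold apex_disc, apex_foot; field; lra).
apply Rmult_le_pos; [nra | left; apply Rinv_0_lt_compat; nra].
Qed.

(** Only [F] and [G] impose conditions: the triangles [DGH] and [FGJ] are equilateral, so [H] and
    [J] exist as soon as [G] does. *)
Lemma harborth_is_configuration (T : R) :
  0 <= T <= 1 -> sqdist (ptA T) (ptE T) <= 4 ->
  0 < sqdist (ptF T) (ptD T) -> 0 <= apex_disc (sqdist (ptF T) (ptD T)) 1 2 ->
  is_harborth_configuration T (harborth T).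
Proof.
intros HT HE Hq HG.
assert (L := leg_sqr T HT); assert (L0 := leg_nonneg T).
assert (S3 := sqrt3_sqr); assert (S3' := sqrt3_bounds).
assert (EE := sqdist_AE T HT).
assert (TL : 0 <= T * leg T) by (apply Rmult_le_pos; lra).
assert (E0 : 3 <= sqdist (ptA T) (ptE T)) by nra.
destruct (apex_spec (ptA T) (ptE T) 1 1) as (F1 & F2 & F3);
  [lra | lra | lra | apply apex_disc_isosceles; lra |].
destruct (apex_spec (ptF T) (ptD T) 1 2) as (G1 & G2 & G3); [lra .. | assumption | ].
fold (ptF T) in F1, F2, F3; fold (ptG T) in G1, G2, G3.
assert (GD := sqdist_of_dist _ _ _ G2).
assert (FG : sqdist (ptF T) (ptG T) = 1).
{ assert (H := sqdist_of_dist _ _ _ G1); revert H.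
  unfold sqdist, dot, vec; cbn [fst snd]; lra. }
destruct (apex_spec (ptG T) (ptD T) 2 2) as (H1 & H2 & H3); try lra.
{ rewrite GD; unfold apex_disc, apex_foot; lra. }
destruct (apex_spec (ptF T) (ptG T) 1 1) as (J1 & J2 & J3); try lra.
{ rewrite FG; unfold apex_disc, apex_foot; lra. }
fold (ptH T) in H1, H2, H3; fold (ptJ T) in J1, J2, J3.
unfold is_harborth_configuration, harborth; cbv zeta;
  cbn [pA pB pC pD pE pF pG pH pJ].
split; [exact HT|]; repeat split; try assumption; try reflexivity.
- unfold opposite_sides.
  (* The product equals [sqrt 3 * (T^2 - t^2) - 2 * T * t] with [t = leg T], and [|AE| <= 2] forces
     [T^2 <= 1/4 <= t^2]. *)
  assert (B0 : cross (vec (ptA T) (ptE T)) (vec (ptA T) (ptB T)) <= 0).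
  { unfold cross, vec, ptA, ptE, ptB; cbn [fst snd]; nra. }
  unfold on_left in F3; nra.
- revert J3; unfold on_left, on_right, cross, vec; cbn [fst snd]; lra.
Qed.

(** * The largest parameter *)

Definition max_parameter : R := sqrt 2 * (3 - sqrt 5) / 8.

(** The equation is the square of [4 * sqrt 3 * T * t = 1 - 4 * T^2], which expresses [|AE| = 2]. It
    has [T^2 = (7 - 3 * sqrt 5) / 16] as its smaller solution; the larger one, with [+], makes
    [1 - 4 * T^2] negative. *)
Lemma max_parameter_sqr :
  64 * max_parameter ^ 4 - 56 * max_parameter ^ 2 + 1 = 0 /\
  0.13504 <= max_parameter < 0.13505.
Proof.
assert (S2 : sqrt 2 * sqrt 2 = 2) by (apply sqrt_sqrt; lra).
assert (S5 : sqrt 5 * sqrt 5 = 5) by (apply sqrt_sqrt; lra).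
assert (P2 := sqrt_pos 2); assert (P5 := sqrt_pos 5).
unfold max_parameter; split.
- assert (E : (sqrt 2 * (3 - sqrt 5) / 8) ^ 2 = (7 - 3 * sqrt 5) / 16) by nra.
  replace ((sqrt 2 * (3 - sqrt 5) / 8) ^ 4)
    with ((sqrt 2 * (3 - sqrt 5) / 8) ^ 2 * (sqrt 2 * (3 - sqrt 5) / 8) ^ 2) by ring.
  rewrite E; nra.
- assert (1.414213 < sqrt 2 < 1.414214) by (split; nra).
  assert (2.236067 < sqrt 5 < 2.236068) by (split; nra).
  split; nra.
Qed.

Lemma sqdist_AE_max_parameter : sqdist (ptA max_parameter) (ptE max_parameter) = 4.
Proof.
destruct max_parameter_sqr as [Hb B]; set (b := max_parameter) in *.
rewrite sqdist_AE by lra.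
assert (L := leg_sqr b ltac:(lra)); assert (L0 := leg_nonneg b).
assert (S3 := sqrt3_sqr); assert (S3' := sqrt3_bounds).
assert (P : 0 <= sqrt 3 * b * leg b)
  by (apply Rmult_le_pos; [apply Rmult_le_pos|]; lra).
assert (E : (4 * (sqrt 3 * b * leg b)) * (4 * (sqrt 3 * b * leg b))
            = (1 - 4 * b * b) * (1 - 4 * b * b)).
{ replace ((4 * (sqrt 3 * b * leg b)) * (4 * (sqrt 3 * b * leg b)))
    with (16 * (sqrt 3 * sqrt 3) * (b * b) * (leg b * leg b)) by ring.
  rewrite S3, L; lra. }
(* Both squared quantities in [E] come from nonnegative numbers, so the squaring can be undone. *)
assert (0 < 1 - 4 * b * b) by nra.
nra.
Qed.

Lemma max_parameter_exists : configuration_exists max_parameter.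
Proof.
exists (harborth max_parameter).
destruct max_parameter_sqr as [_ B]; assert (AE := sqdist_AE_max_parameter).
set (b := max_parameter) in *.
assert (HT : 0 <= b <= 1) by lra.
assert (L := leg_sqr b HT); assert (S3 := sqrt3_sqr).
assert (AE' := sqdist_AE b HT).
(* With [F] the midpoint of [AE], the squared distance is [13/4 + 2 * sqrt 3 * b * leg b], which
   [|AE| = 2] turns into [15/4 - 2 * b^2]. *)
assert (FD : 1 <= sqdist (ptF b) (ptD b) <= 9).
{ unfold ptF, apex; rewrite AE.
  replace (apex_disc 4 1 1) with 0 by (unfold apex_disc, apex_foot; field).
  replace (apex_foot 4 1 1) with (/ 2) by (unfold apex_foot; field).
  rewrite sqrt_0; unfold sqdist, dot, vec, ptA, ptD, ptE; cbn [fst snd].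
  nra. }
apply harborth_is_configuration; [assumption | lra | lra |].
now apply apex_disc_1_2.
Qed.

(** Parallelogram law: [|P - Q|^2 + |2 X - P - Q|^2 = 2 |X - P|^2 + 2 |X - Q|^2 = 4]. *)
Lemma sqdist_le_of_common_point (P Q X : point) :
  dist X P = 1 -> dist X Q = 1 -> sqdist P Q <= 4.
Proof.
intros H1 H2; apply sqdist_of_dist in H1; apply sqdist_of_dist in H2.
unfold sqdist, dot, vec in *; cbn [fst snd] in *.
assert (0 <= (2 * fst X - fst P - fst Q) ^ 2) by apply pow2_ge_0.
assert (0 <= (2 * snd X - snd P - snd Q) ^ 2) by apply pow2_ge_0.
lra.
Qed.

Lemma configuration_exists_le (T : R) :
  configuration_exists T -> T <= max_parameter.
Proof.
intros [c (HT & HA & HB & _ & _ & HE & (F1 & F2 & _) & _)]; cbv zeta in *.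
assert (Q := sqdist_le_of_common_point _ _ _ F1 F2).
rewrite HA, HE in Q; change (sqdist (ptA T) (ptE T) <= 4) in Q.
rewrite sqdist_AE in Q by assumption.
assert (L := leg_sqr T HT); assert (L0 := leg_nonneg T).
destruct max_parameter_sqr as [Hb B]; set (b := max_parameter) in *.
assert (S3 := sqrt3_sqr); assert (S3' := sqrt3_bounds).
assert (P : 0 <= sqrt 3 * T * leg T)
  by (apply Rmult_le_pos; [apply Rmult_le_pos|]; lra).
assert (E : (4 * (sqrt 3 * T * leg T)) * (4 * (sqrt 3 * T * leg T))
            = 48 * (T * T) * (1 - T * T)).
{ replace ((4 * (sqrt 3 * T * leg T)) * (4 * (sqrt 3 * T * leg T)))
    with (16 * (sqrt 3 * sqrt 3) * (T * T) * (leg T * leg T)) by ring.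
  rewrite S3, L; lra. }
(* This excludes the larger root of the quartic: as a polynomial in [T^2] it is decreasing up to
   [7/16]. *)
assert (T2 : 4 * (T * T) <= 1) by lra.
assert (K : 0 <= 64 * (T * T) * (T * T) - 56 * (T * T) + 1).
{ assert (4 * (sqrt 3 * T * leg T) <= 1 - 4 * (T * T)) by lra.
  assert (48 * (T * T) * (1 - T * T) <= (1 - 4 * (T * T)) * (1 - 4 * (T * T)))
    by (rewrite <- E; apply Rmult_le_compat; lra).
  lra. }
destruct (Rle_lt_dec T b) as [|C]; [assumption|exfalso].
assert (C2 : b * b < T * T) by nra.
(* Difference of the values of [64 x^2 - 56 x + 1] at [T^2] and at its root [b^2]. *)
assert (0 <= (T * T - b * b) * (64 * (T * T + b * b) - 56)) by nra.
nra.
Qed.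

Lemma largest_max_parameter : largest_parameter max_parameter.
Proof.
split; [apply max_parameter_exists | intros T; apply configuration_exists_le].
Qed.

(** * Enclosure of the solution *)

Definition sqrt3_itv : itv := isqrt (icst 3).
Definition half_itv : itv := iinv (icst 2).
(** The factor [icst 1] reflects that [T ^ 2] unfolds to [T * (T * 1)]. *)
Definition leg_sqr_itv (I : itv) : itv := isub (icst 1) (imul I (imul I (icst 1))).
Definition leg_itv (I : itv) : itv := isqrt (leg_sqr_itv I).
Definition boxA : box := (icst 0, icst 0).
Definition boxB (I : itv) : box := (leg_itv I, I).
Definition boxC (I : itv) : box := (imul (icst 2) (leg_itv I), icst 0).
Definition boxD (I : itv) : box :=
  (imul half_itv (iadd (imul (imul (icst 3) sqrt3_itv) I) (leg_itv I)),
   imul (imul (icst 3) half_itv) (iadd I (imul sqrt3_itv (leg_itv I)))).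
Definition boxE (I : itv) : box :=
  (imul sqrt3_itv I, iadd (imul (icst 2) I) (imul sqrt3_itv (leg_itv I))).
Definition boxF (I : itv) : box := apex_box boxA (boxE I) 1 1.
Definition boxG (I : itv) : box := apex_box (boxF I) (boxD I) 1 2.
Definition boxH (I : itv) : box := apex_box (boxG I) (boxD I) 2 2.
Definition boxJ (I : itv) : box := apex_box (boxF I) (boxG I) 1 1.

Definition boxes_ok (I : itv) : bool :=
  ipos (leg_sqr_itv I) && apex_ok boxA (boxE I) 1 1 &&
  apex_ok (boxF I) (boxD I) 1 2 && apex_ok (boxG I) (boxD I) 2 2 &&
  apex_ok (boxF I) (boxG I) 1 1.

Lemma enclp_points (I : itv) :
  boxes_ok I = true ->
  (enclp I ptA boxA /\ enclp I ptB (boxB I) /\ enclp I ptC (boxC I) /\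
   enclp I ptD (boxD I) /\ enclp I ptE (boxE I) /\ enclp I ptF (boxF I) /\
   enclp I ptG (boxG I) /\ enclp I ptH (boxH I) /\ enclp I ptJ (boxJ I)) /\
  forall T, mem I T -> 0 < sqdist (ptF T) (ptD T) /\
    0 < apex_disc (sqdist (ptF T) (ptD T)) 1 2.
Proof.
intros H; unfold boxes_ok in H; rewrite !andb_true_iff in H.
destruct H as ((((HL & HF) & HG) & HH) & HJ).
assert (L : encl I leg (leg_itv I)).
{ change (encl I (fun T => sqrt (1 - T * (T * 1))) (leg_itv I)).
  unfold leg_itv, leg_sqr_itv in *; enclose. }
assert (S : encl I (fun _ => sqrt 3) sqrt3_itv) by (unfold sqrt3_itv; enclose).
assert (W : encl I (fun _ => / 2) half_itv) by (unfold half_itv; enclose).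
assert (A : enclp I ptA boxA) by (split; cbn [fst snd ptA boxA]; enclose).
assert (B : enclp I ptB (boxB I)) by (split; cbn [fst snd ptB boxB]; enclose).
assert (C : enclp I ptC (boxC I)) by (split; cbn [fst snd ptC boxC]; enclose).
assert (D : enclp I ptD (boxD I)).
{ split; cbn [fst snd ptD boxD]; [|unfold Rdiv]; enclose. }
assert (E : enclp I ptE (boxE I)) by (split; cbn [fst snd ptE boxE]; enclose).
destruct (enclp_apex I _ _ _ _ 1 1 A E HF) as [F _].
destruct (enclp_apex I _ _ _ _ 1 2 F D HG) as [G G'].
destruct (enclp_apex I _ _ _ _ 2 2 G D HH) as [HH' _].
destruct (enclp_apex I _ _ _ _ 1 1 F G HJ) as [J _].
split; [|exact G'].
exact (conj A (conj B (conj C (conj D (conj E (conj F (conj G (conj HH' J)))))))).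
Qed.

Definition root_lo : Z := 120720000.
Definition root_hi : Z := 120730000.
Definition root_itv : itv := (root_lo, root_hi).

Definition offset (T : R) : R := fst (ptJ T) - fst (ptH T).
Definition offset_itv (I : itv) : itv := isub (fst (boxJ I)) (fst (boxH I)).

Lemma encl_offset (I : itv) :
  boxes_ok I = true -> encl I offset (offset_itv I).
Proof.
intros H; destruct (enclp_points I H) as [(_ & _ & _ & _ & _ & _ & _ & [X _] & [Y _]) _].
exact (encl_isub I _ _ _ _ Y X).
Qed.

Lemma mem_thin (n : Z) : mem (n, n) (IZR n / IZR scale).
Proof.
assert (S := scale_pos); unfold mem; cbn [fst snd].
replace (IZR n / IZR scale * IZR scale) with (IZR n) by (field; lra); lra.
Qed.

(** Over the whole interval the enclosure of [offset] must contain 0 and shows only continuity; the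
    signs at the ends come from the degenerate intervals [(n, n)]. *)
Lemma offset_root : exists T, mem root_itv T /\ offset T = 0.
Proof.
assert (S := scale_pos).
destruct (IVT_interv offset (IZR root_lo / IZR scale) (IZR root_hi / IZR scale))
  as [T [HT HR]].
- intros T HT.
  apply (encl_offset root_itv); [vm_compute; reflexivity|].
  assert (L := mem_thin root_lo); assert (U := mem_thin root_hi).
  unfold mem in *; cbn [fst snd root_itv] in *; nra.
- apply Rmult_lt_compat_r; [now apply Rinv_0_lt_compat | now apply IZR_lt].
- destruct (encl_offset (root_lo, root_lo) ltac:(vm_compute; reflexivity) _ (mem_thin root_lo)) as [M _].
  apply mem_iopp, ipos_spec in M; [lra | vm_compute; reflexivity].
- destruct (encl_offset (root_hi, root_hi) ltac:(vm_compute; reflexivity) _ (mem_thin root_hi)) as [M _].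
  apply ipos_spec in M; [assumption | vm_compute; reflexivity].
- exists T; split; [|assumption].
  assert (L := mem_thin root_lo); assert (U := mem_thin root_hi).
  unfold mem in *; cbn [fst snd root_itv] in *; nra.
Qed.

(** * Gluing four copies of the quarter *)

Lemma in_segment_sym (P Q X : point) : in_segment P Q X -> in_segment Q P X.
Proof.
intros (s & Hs & ->); exists (1 - s); split; [lra|]; f_equal; ring.
Qed.

(** A convex combination of nonnegative ordinates vanishes only if each weighted term does.
    Positivity of the sum rules out a segment inside the line. *)
Lemma in_segment_edge_snd (P Q X : point) :
  in_segment P Q X -> 0 <= snd P -> 0 <= snd Q -> 0 < snd P + snd Q -> snd X = 0 ->
  X = P /\ snd P = 0 \/ X = Q /\ snd Q = 0.
Proof.
intros (s & Hs & ->) HP HQ H; destruct P as [p p'], Q as [q q']; cbn [fst snd] in *.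
intros E; assert (E1 : (1 - s) * p' = 0) by nra; assert (E2 : s * q' = 0) by nra.
apply Rmult_integral in E1; apply Rmult_integral in E2.
assert (C : s = 0 /\ p' = 0 \/ s = 1 /\ q' = 0) by lra.
destruct C as [[-> ->] | [-> ->]]; [left | right]; split; try f_equal; ring.
Qed.

Lemma in_segment_edge_fst (h : R) (P Q X : point) :
  in_segment P Q X -> h <= fst P -> h <= fst Q -> 2 * h < fst P + fst Q -> fst X = h ->
  X = P /\ fst P = h \/ X = Q /\ fst Q = h.
Proof.
intros (s & Hs & ->) HP HQ H; destruct P as [p p'], Q as [q q']; cbn [fst snd] in *.
intros E; assert (E1 : (1 - s) * (p - h) = 0) by nra.
assert (E2 : s * (q - h) = 0) by nra.
apply Rmult_integral in E1; apply Rmult_integral in E2.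
assert (C : s = 0 /\ p = h \/ s = 1 /\ q = h) by lra.
destruct C as [[-> ->] | [-> ->]]; [left | right]; split; try f_equal; ring.
Qed.

Definition mirror (h : R) (r1 r2 : bool) (P : point) : point :=
  (if r2 then 2 * h - fst P else fst P, if r1 then - snd P else snd P).

(** A vertex on a mirror line carries no flag for the reflection that fixes it; [false] stands in
    for that flag, and [glued_copy] shows that either value gives the same point. *)
Definition glued (h : R) (pos : quarter_vertex -> point) (v : harborth_vertex) : point :=
  match v with
  | HMirror1 x r2 => mirror h false r2 (pos (OnMirror1 x))
  | HMirror2 x r1 => mirror h r1 false (pos (OnMirror2 x))
  | HFree x r1 r2 => mirror h r1 r2 (pos (Free x))
  end.

Lemma mirror_involutive (h : R) (r1 r2 : bool) (P : point) :
  mirror h r1 r2 (mirror h r1 r2 P) = P.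
Proof.
destruct P, r1, r2; unfold mirror; cbn [fst snd]; f_equal; ring.
Qed.

Lemma mirror_in_segment (h : R) (r1 r2 : bool) (P Q X : point) :
  in_segment P Q X ->
  in_segment (mirror h r1 r2 P) (mirror h r1 r2 Q) (mirror h r1 r2 X).
Proof.
intros (s & Hs & ->); exists s; split; [assumption|].
destruct r1, r2; unfold mirror; cbn [fst snd]; f_equal; ring.
Qed.

Lemma mirror_dist (h : R) (r1 r2 : bool) (P Q : point) :
  dist (mirror h r1 r2 P) (mirror h r1 r2 Q) = dist P Q.
Proof.
destruct r1, r2; unfold mirror, dist, dist_euc, Rsqr; cbn [fst snd]; f_equal; ring.
Qed.

Lemma in_harborth_edges (x y : harborth_vertex) :
  In (x, y) harborth_edges ->
  exists r1 r2 a b, In (a, b) quarter_edges /\ x = copy r1 r2 a /\ y = copy r1 r2 b.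
Proof.
intros H; apply in_flat_map in H; destruct H as ([r1 r2] & _ & H).
apply in_map_iff in H; destruct H as ([a b] & E & H); cbn [fst snd] in E.
injection E as <- <-; exists r1, r2, a, b; auto.
Qed.

(** An edge inside a mirror line would coincide with its own mirror image, and the two copies would
    overlap along it. *)
Lemma edge_not_in_mirror (a b : quarter_vertex) :
  In (a, b) quarter_edges ->
  ~ (exists x y, a = OnMirror1 x /\ b = OnMirror1 y) /\
  ~ (exists x y, a = OnMirror2 x /\ b = OnMirror2 y).
Proof.
intros H; cbn [quarter_edges In] in H.
repeat (destruct H as [H | H]);
  [injection H as <- <-; split; intros (x & y & E1 & E2); discriminate .. | easy].
Qed.

Section Gluing.

Variables (pos : quarter_vertex -> point) (h : R).
Hypothesis pos_mirror1 :
  forall x, snd (pos (OnMirror1 x)) = 0 /\ h < fst (pos (OnMirror1 x)).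
Hypothesis pos_mirror2 :
  forall x, fst (pos (OnMirror2 x)) = h /\ 0 < snd (pos (OnMirror2 x)).
Hypothesis pos_free :
  forall x, h < fst (pos (Free x)) /\ 0 < snd (pos (Free x)).
Hypothesis pos_drawing : planar_unit_distance_drawing quarter_edges pos.

Lemma glued_copy (r1 r2 : bool) (q : quarter_vertex) :
  glued h pos (copy r1 r2 q) = mirror h r1 r2 (pos q).
Proof.
destruct q as [x | x | x]; cbn [glued copy]; [| | reflexivity].
- destruct (pos_mirror1 x); unfold mirror; f_equal; destruct r1; lra.
- destruct (pos_mirror2 x); unfold mirror; f_equal; destruct r2; lra.
Qed.

(** The side of each mirror line on which a point lies determines the flags; what remains is
    injectivity of [pos]. *)
Lemma glued_injective (v w : harborth_vertex) :
  glued h pos v = glued h pos w -> v = w.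
Proof.
destruct pos_drawing as [inj _]; intros E.
assert (E1 := f_equal fst E); assert (E2 := f_equal snd E); clear E.
destruct v as [x r2 | x r1 | x r1 r2], w as [y s2 | y s1 | y s1 s2];
  cbn [glued mirror fst snd] in E1, E2;
  try destruct (pos_mirror1 x); try destruct (pos_mirror1 y);
  try destruct (pos_mirror2 x); try destruct (pos_mirror2 y);
  try destruct (pos_free x); try destruct (pos_free y);
  repeat match goal with b : bool |- _ => destruct b end; try lra;
  match goal with
  | _ : context [pos ?p], _ : context [pos ?q] |- _ =>
      assert (E : p = q)
        by (apply inj; rewrite (surjective_pairing (pos p)),
              (surjective_pairing (pos q)); f_equal; lra);
      injection E as ->; reflexivity
  end.
Qed.

Lemma pos_quadrant (q : quarter_vertex) :
  (h <= fst (pos q) /\ (fst (pos q) = h -> exists x, q = OnMirror2 x)) /\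
  (0 <= snd (pos q) /\ (snd (pos q) = 0 -> exists x, q = OnMirror1 x)).
Proof.
destruct q as [x | x | x];
  [destruct (pos_mirror1 x) | destruct (pos_mirror2 x) | destruct (pos_free x)];
  repeat split; try lra; intros; try lra; exists x; reflexivity.
Qed.

Lemma in_segment_quadrant (P Q X : point) :
  in_segment P Q X -> h <= fst P -> h <= fst Q -> 0 <= snd P -> 0 <= snd Q ->
  h <= fst X /\ 0 <= snd X.
Proof. intros (s & Hs & ->) ? ? ? ?; cbn [fst snd]; nra. Qed.

Lemma edge_meets_mirror (a b : quarter_vertex) (X : point) :
  In (a, b) quarter_edges -> in_segment (pos a) (pos b) X ->
  fst X = h \/ snd X = 0 -> exists w, (w = a \/ w = b) /\ X = pos w.
Proof.
intros H S C; destruct (edge_not_in_mirror a b H) as [N1 N2].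
destruct (pos_quadrant a) as [[A1 A2] [A3 A4]].
destruct (pos_quadrant b) as [[B1 B2] [B3 B4]].
destruct C as [C | C].
- assert (P : 2 * h < fst (pos a) + fst (pos b)).
  { destruct (Rle_lt_dec (fst (pos a) + fst (pos b)) (2 * h)); [|lra].
    exfalso; apply N2; destruct (A2 ltac:(lra)) as [x ->], (B2 ltac:(lra)) as [y ->].
    now exists x, y. }
  destruct (in_segment_edge_fst h _ _ _ S A1 B1 P C) as [[-> _] | [-> _]];
    [exists a | exists b]; auto.
- assert (P : 0 < snd (pos a) + snd (pos b)).
  { destruct (Rle_lt_dec (snd (pos a) + snd (pos b)) 0); [|lra].
    exfalso; apply N1; destruct (A4 ltac:(lra)) as [x ->], (B4 ltac:(lra)) as [y ->].
    now exists x, y. }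
  destruct (in_segment_edge_snd _ _ _ S A3 B3 P C) as [[-> _] | [-> _]];
    [exists a | exists b]; auto.
Qed.

(* Different copies lie on different sides of one of the two mirror lines, so two
   of their edges can only meet in a point of that line, hence in end points. *)
Lemma glued_drawing : planar_unit_distance_drawing harborth_edges (glued h pos).
Proof.
split; [exact glued_injective|split].
- intros x y H; apply in_harborth_edges in H.
  destruct H as (r1 & r2 & a & b & H & -> & ->).
  rewrite !glued_copy, mirror_dist; now apply pos_drawing.
- intros x y u v p H1 H2 N S1 S2.
  apply in_harborth_edges in H1; destruct H1 as (r1 & r2 & a & b & H1 & -> & ->).
  apply in_harborth_edges in H2; destruct H2 as (s1 & s2 & c & d & H2 & -> & ->).
  rewrite !glued_copy in S1, S2.
  apply (mirror_in_segment h r1 r2) in S1; rewrite !mirror_involutive in S1.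
  apply (mirror_in_segment h s1 s2) in S2; rewrite !mirror_involutive in S2.
  assert (C : (r1 = s1 /\ r2 = s2) \/
    ((fst (mirror h r1 r2 p) = h \/ snd (mirror h r1 r2 p) = 0) /\
     (fst (mirror h s1 s2 p) = h \/ snd (mirror h s1 s2 p) = 0))).
  { destruct (pos_quadrant a) as [[A1 _] [A2 _]], (pos_quadrant b) as [[B1 _] [B2 _]].
    destruct (pos_quadrant c) as [[C1 _] [C2 _]], (pos_quadrant d) as [[D1 _] [D2 _]].
    destruct (in_segment_quadrant _ _ _ S1) as [Q1 Q2]; try assumption.
    destruct (in_segment_quadrant _ _ _ S2) as [Q3 Q4]; try assumption.
    unfold mirror in *; cbn [fst snd] in *.
    destruct r1, s1, r2, s2; auto; right; lra. }
  destruct C as [[-> ->] | [M1 M2]].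
  + assert (N' : (a, b) <> (c, d)) by (intros E; injection E as -> ->; now apply N).
    destruct pos_drawing as (_ & _ & pl).
    destruct (pl _ _ _ _ _ H1 H2 N' S1 S2) as (w & W1 & W2 & E).
    exists (copy s1 s2 w); split; [|split].
    * destruct W1 as [-> | ->]; auto.
    * destruct W2 as [-> | ->]; auto.
    * rewrite glued_copy, <- E; symmetry; apply mirror_involutive.
  + destruct (edge_meets_mirror _ _ _ H1 S1 M1) as (w & W1 & E1).
    destruct (edge_meets_mirror _ _ _ H2 S2 M2) as (w' & W2 & E2).
    apply (f_equal (mirror h r1 r2)) in E1; rewrite mirror_involutive in E1.
    apply (f_equal (mirror h s1 s2)) in E2; rewrite mirror_involutive in E2.
    rewrite <- glued_copy in E1, E2.
    assert (E : copy r1 r2 w = copy s1 s2 w') by (apply glued_injective; congruence).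
    exists (copy r1 r2 w); split; [|split; [|assumption]].
    * destruct W1 as [-> | ->]; auto.
    * rewrite E; destruct W2 as [-> | ->]; auto.
Qed.

End Gluing.

(** * Planarity of the quarter *)

(** The second alternative is for straight angles at subdivision points such as [C1] between [C] and
    [C2]: there the cross product is exactly 0, which no enclosure can separate from 0, whereas the
    dot product is clearly negative. *)
Lemma meet_at_corner (O P Q X : point) :
  cross (vec O P) (vec O Q) <> 0 \/ dot (vec O P) (vec O Q) < 0 ->
  in_segment O P X -> in_segment O Q X -> X = O.
Proof.
intros C (s & Hs & E) (r & Hr & ->).
destruct O as [ox oy], P as [px py], Q as [qx qy].
unfold cross, dot, vec in C; cbn [fst snd] in *; injection E as E1 E2.
set (u := px - ox) in *; set (u' := py - oy) in *.
set (v := qx - ox) in *; set (v' := qy - oy) in *.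
assert (F1 : r * v = s * u) by (unfold u, v; lra).
assert (F2 : r * v' = s * u') by (unfold u', v'; lra).
assert (Z : r * v = 0 /\ r * v' = 0).
{ destruct C as [C | C].
  - assert (K : r * (u * v' - u' * v) = 0).
    { replace (r * (u * v' - u' * v)) with (u * (r * v') - u' * (r * v)) by ring.
      rewrite F1, F2; ring. }
    apply Rmult_integral in K; destruct K as [-> | K]; [lra | contradiction].
  - assert (K : (r * v) * (r * v) + (r * v') * (r * v') = r * s * (u * v + u' * v')).
    { rewrite F1 at 1; rewrite F2 at 1; ring. }
    assert (0 <= r * s) by nra.
    assert (r * s * (u * v + u' * v') <= 0) by nra.
    split; nra. }
unfold v, v' in Z; f_equal; lra.
Qed.

(** The cross product is affine in its moving point, so it keeps its strict sign along [UV], while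
    it vanishes on [PQ]. *)
Lemma separated_by_line (P Q U V X : point) :
  0 < cross (vec P Q) (vec P U) * cross (vec P Q) (vec P V) ->
  in_segment P Q X -> in_segment U V X -> False.
Proof.
intros C (s & Hs & E) (r & Hr & ->).
assert (K : (1 - r) * cross (vec P Q) (vec P U) + r * cross (vec P Q) (vec P V) = 0).
{ injection E as E1 E2; unfold cross, vec; cbn [fst snd].
  transitivity ((fst Q - fst P) * ((1 - r) * snd U + r * snd V - snd P)
    - (snd Q - snd P) * ((1 - r) * fst U + r * fst V - fst P)); [ring|].
  rewrite E1, E2; ring. }
set (c := cross _ (vec P U)) in *; set (d := cross _ (vec P V)) in *; clearbody c d.
clear E; destruct (Rlt_le_dec 0 c).
- assert (0 < d) by (apply Rmult_lt_reg_l with c; lra); nra.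
- assert (c < 0) by (destruct (Req_dec c 0) as [-> |]; lra).
  assert (d < 0) by (apply Rmult_lt_reg_l with (- c); lra); nra.
Qed.

(** Meant for disjoint edges on one line, such as the outer thirds of [CD]: the line through either
    contains the other, so [separated_by_line] cannot apply. *)
Lemma separated_by_height (P Q U V X : point) :
  snd P < snd U -> snd P < snd V -> snd Q < snd U -> snd Q < snd V ->
  in_segment P Q X -> in_segment U V X -> False.
Proof.
intros H1 H2 H3 H4 (s & Hs & E) (r & Hr & ->); injection E as _ E.
set (m := Rmax (snd P) (snd Q)).
assert (MP : snd P <= m) by apply Rmax_l; assert (MQ : snd Q <= m) by apply Rmax_r.
assert (MU : m < snd U) by (apply Rmax_lub_lt; assumption).
assert (MV : m < snd V) by (apply Rmax_lub_lt; assumption).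
assert (0 <= (1 - s) * (m - snd P)) by (apply Rmult_le_pos; lra).
assert (0 <= s * (m - snd Q)) by (apply Rmult_le_pos; lra).
assert (0 <= (1 - r) * (snd U - m)) by (apply Rmult_le_pos; lra).
assert (0 <= r * (snd V - m)) by (apply Rmult_le_pos; lra).
(* One of the weights [1 - r] and [r] is positive, which makes the ordinate on [UV] strictly larger
   than [m]. *)
destruct (Rle_lt_dec r (/ 2)).
- assert (0 < (1 - r) * (snd U - m)) by (apply Rmult_lt_0_compat; lra); lra.
- assert (0 < r * (snd V - m)) by (apply Rmult_lt_0_compat; lra); lra.
Qed.

Definition inonzero (J : itv) : bool := ipos J || ipos (iopp J).

Lemma inonzero_spec (J : itv) (x : R) : inonzero J = true -> mem J x -> x <> 0.
Proof.
intros H M; apply orb_prop in H; destruct H as [H | H].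
- assert (A := ipos_spec _ _ H M); lra.
- assert (A := ipos_spec _ _ H (mem_iopp _ _ M)); lra.
Qed.

Lemma memp_ivec (B C : box) (P Q : point) :
  memp B P -> memp C Q -> memp (ivec B C) (vec P Q).
Proof. intros [] []; split; apply mem_isub; assumption. Qed.

Lemma mem_idot (B C : box) (u v : point) :
  memp B u -> memp C v -> mem (idot B C) (dot u v).
Proof. intros [] []; apply mem_iadd; apply mem_imul; assumption. Qed.

Lemma mem_icross (B C : box) (u v : point) :
  memp B u -> memp C v -> mem (icross B C) (cross u v).
Proof. intros [] []; apply mem_isub; apply mem_imul; assumption. Qed.

Definition corner_ok (O P Q : box) : bool :=
  inonzero (icross (ivec O P) (ivec O Q)) || ipos (iopp (idot (ivec O P) (ivec O Q))).
Definition line_ok (P Q U V : box) : bool :=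
  ipos (imul (icross (ivec P Q) (ivec P U)) (icross (ivec P Q) (ivec P V))).
Definition below (P U : box) : bool := ipos (isub (snd U) (snd P)).
Definition height_ok (P Q U V : box) : bool :=
  below P U && below P V && below Q U && below Q V.
Definition distinct_ok (P Q : box) : bool :=
  inonzero (isub (fst P) (fst Q)) || inonzero (isub (snd P) (snd Q)).

Lemma corner_ok_spec (BO BP BQ : box) (O P Q X : point) :
  memp BO O -> memp BP P -> memp BQ Q -> corner_ok BO BP BQ = true ->
  in_segment O P X -> in_segment O Q X -> X = O.
Proof.
intros MO MP MQ H; apply meet_at_corner.
assert (MP' := memp_ivec _ _ _ _ MO MP); assert (MQ' := memp_ivec _ _ _ _ MO MQ).
apply orb_prop in H; destruct H as [H | H]; [left | right].
- exact (inonzero_spec _ _ H (mem_icross _ _ _ _ MP' MQ')).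
- assert (A := ipos_spec _ _ H (mem_iopp _ _ (mem_idot _ _ _ _ MP' MQ'))); lra.
Qed.

Lemma line_ok_spec (BP BQ BU BV : box) (P Q U V X : point) :
  memp BP P -> memp BQ Q -> memp BU U -> memp BV V -> line_ok BP BQ BU BV = true ->
  in_segment P Q X -> in_segment U V X -> False.
Proof.
intros MP MQ MU MV H; apply separated_by_line.
apply (ipos_spec _ _ H), mem_imul; apply mem_icross; now apply memp_ivec.
Qed.

Lemma below_spec (BP BU : box) (P U : point) :
  memp BP P -> memp BU U -> below BP BU = true -> snd P < snd U.
Proof.
intros [_ MP] [_ MU] H.
assert (A := ipos_spec _ _ H (mem_isub _ _ _ _ MU MP)); lra.
Qed.

Lemma height_ok_spec (BP BQ BU BV : box) (P Q U V X : point) :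
  memp BP P -> memp BQ Q -> memp BU U -> memp BV V -> height_ok BP BQ BU BV = true ->
  in_segment P Q X -> in_segment U V X -> False.
Proof.
intros MP MQ MU MV H; unfold height_ok in H; rewrite !andb_true_iff in H.
destruct H as [[[? ?] ?] ?].
apply separated_by_height; eapply below_spec; eassumption.
Qed.

Lemma distinct_ok_spec (BP BQ : box) (P Q : point) :
  memp BP P -> memp BQ Q -> distinct_ok BP BQ = true -> P <> Q.
Proof.
intros [P1 P2] [Q1 Q2] H ->; apply orb_prop in H; destruct H as [H | H].
- apply (inonzero_spec _ _ H (mem_isub _ _ _ _ P1 Q1)); ring.
- apply (inonzero_spec _ _ H (mem_isub _ _ _ _ P2 Q2)); ring.
Qed.

Definition quarter_vertex_eq_dec (a b : quarter_vertex) : {a = b} + {a <> b}.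
Proof. repeat decide equality. Defined.

Definition quarter_vertices : list quarter_vertex :=
  map OnMirror1 [vA; vC] ++ map OnMirror2 [vH; vJ] ++
  map Free [vB; vD; vE; vF; vG; vB1; vC1; vC2; vDG; vDH; vGH].

Lemma quarter_vertices_complete (q : quarter_vertex) : In q quarter_vertices.
Proof. destruct q as [x | x | x]; destruct x; vm_compute; tauto. Qed.

Section BoxDrawing.

Variable bx : quarter_vertex -> box.

(** The line test is tried in both roles: of two disjoint segments that are not collinear, at least
    one misses the line through the other, but not necessarily a prescribed one. *)
Definition edges_ok (e f : quarter_vertex * quarter_vertex) : bool :=
  let (a, b) := e in let (u, v) := f in
  if quarter_vertex_eq_dec a u then
    if quarter_vertex_eq_dec b v then true else corner_ok (bx a) (bx b) (bx v)
  else if quarter_vertex_eq_dec a v then corner_ok (bx a) (bx b) (bx u)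
  else if quarter_vertex_eq_dec b u then corner_ok (bx b) (bx a) (bx v)
  else if quarter_vertex_eq_dec b v then corner_ok (bx b) (bx a) (bx u)
  else line_ok (bx a) (bx b) (bx u) (bx v) || line_ok (bx u) (bx v) (bx a) (bx b) ||
    height_ok (bx a) (bx b) (bx u) (bx v) || height_ok (bx u) (bx v) (bx a) (bx b).

Definition drawing_ok : bool :=
  forallb (fun a => forallb (fun b =>
    if quarter_vertex_eq_dec a b then true else distinct_ok (bx a) (bx b))
    quarter_vertices) quarter_vertices &&
  forallb (fun e => forallb (edges_ok e) quarter_edges) quarter_edges.

Lemma drawing_ok_spec (pos : quarter_vertex -> point) :
  (forall q, memp (bx q) (pos q)) -> drawing_ok = true ->
  (forall x y, In (x, y) quarter_edges -> dist (pos x) (pos y) = 1) ->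
  planar_unit_distance_drawing quarter_edges pos.
Proof.
intros M H D; apply andb_prop in H; destruct H as [H1 H2].
split; [|split; [assumption|]].
- intros x y E.
  rewrite forallb_forall in H1; specialize (H1 x (quarter_vertices_complete x)).
  rewrite forallb_forall in H1; specialize (H1 y (quarter_vertices_complete y)).
  cbv beta in H1; destruct (quarter_vertex_eq_dec x y) as [|N]; [assumption|].
  now destruct (distinct_ok_spec _ _ _ _ (M x) (M y) H1).
- intros a b u v p Hab Huv N S1 S2.
  rewrite forallb_forall in H2; specialize (H2 _ Hab).
  rewrite forallb_forall in H2; specialize (H2 _ Huv); unfold edges_ok in H2.
  assert (S1' := in_segment_sym _ _ _ S1); assert (S2' := in_segment_sym _ _ _ S2).
  destruct (quarter_vertex_eq_dec a u) as [<- | _];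
  [destruct (quarter_vertex_eq_dec b v) as [<- | _]; [now destruct N|]|
   destruct (quarter_vertex_eq_dec a v) as [<- | _];
   [|destruct (quarter_vertex_eq_dec b u) as [<- | _];
   [|destruct (quarter_vertex_eq_dec b v) as [<- | _]]]].
  + exists a; split; [auto|split; [auto|]]; eapply corner_ok_spec; eauto.
  + exists a; split; [auto|split; [auto|]]; eapply corner_ok_spec; eauto.
  + exists b; split; [auto|split; [auto|]]; eapply corner_ok_spec; eauto.
  + exists b; split; [auto|split; [auto|]]; eapply corner_ok_spec; eauto.
  + exfalso; rewrite !orb_true_iff in H2; destruct H2 as [[[H2 | H2] | H2] | H2].
    * exact (line_ok_spec _ _ _ _ _ _ _ _ p (M a) (M b) (M u) (M v) H2 S1 S2).
    * exact (line_ok_spec _ _ _ _ _ _ _ _ p (M u) (M v) (M a) (M b) H2 S2 S1).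
    * exact (height_ok_spec _ _ _ _ _ _ _ _ p (M a) (M b) (M u) (M v) H2 S1 S2).
    * exact (height_ok_spec _ _ _ _ _ _ _ _ p (M u) (M v) (M a) (M b) H2 S2 S1).
Qed.

End BoxDrawing.

(** * Edge lengths and boxes of the quarter *)

Lemma quarter_edge_length (T : R) (c : configuration) (a b : quarter_vertex) :
  is_harborth_configuration T c -> In (a, b) quarter_edges ->
  dist (quarter_position c a) (quarter_position c b) = 1.
Proof.
intros (HT & HA & HB & HC & HD & HE & (FA & FE & _) & (GF & GD & _) &
        (HD' & HG & _) & (JF & JG & _)) H; cbv zeta in *.
assert (L := leg_sqr T HT); assert (S3 := sqrt3_sqr); unfold leg in L.
set (t := sqrt (1 - T ^ 2)) in *; set (w := sqrt 3) in *; clearbody t w.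
apply sqdist_of_dist in FA, FE, GF, GD, HD', HG, JF, JG.
apply dist_of_sqdist; [lra|].
cbn [quarter_edges In] in H.
repeat (destruct H as [H | H]); [injection H as <- <- .. | easy];
  cbn [quarter_position];
  (* Some edges are defining distances. Those of the triangle [DGH] are halves of sides or midlines,
     so their squared lengths are linear in given ones. Those of the trapezoid rest on
     [T^2 + t^2 = 1] and [w^2 = 3]. *)
  first [ assumption
        | revert FA FE GF GD HD' HG JF JG; rewrite ?HA, ?HB, ?HC, ?HD, ?HE;
          unfold subdivide, sqdist, dot, vec; cbn [fst snd]; intros; lra
        | rewrite ?HA, ?HB, ?HC, ?HD, ?HE; clear - L S3;
          unfold subdivide, sqdist, dot, vec; cbn [fst snd]; nra ].
Qed.

Definition isubdivide (B C : box) (s : itv) : box :=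
  (iadd (fst B) (imul s (isub (fst C) (fst B))),
   iadd (snd B) (imul s (isub (snd C) (snd B)))).

Lemma memp_isubdivide (B C : box) (J : itv) (P Q : point) (s : R) :
  memp B P -> memp C Q -> mem J s -> memp (isubdivide B C J) (subdivide P Q s).
Proof.
intros [P1 P2] [Q1 Q2] Hs.
split; (apply mem_iadd; [assumption | apply mem_imul; [assumption | now apply mem_isub]]).
Qed.

Definition fraction_itv (m n : Z) : itv := imul (icst m) (iinv (icst n)).

Lemma mem_fraction_itv (m n : Z) :
  (0 < n)%Z -> mem (fraction_itv m n) (IZR m / IZR n).
Proof.
intros H; apply mem_imul; [apply mem_icst | apply mem_iinv; [|apply mem_icst]].
apply Z.ltb_lt; unfold icst, scale; cbn [fst]; lia.
Qed.

Definition quarter_box (I : itv) (q : quarter_vertex) : box :=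
  match q with
  | OnMirror1 vA => boxA
  | OnMirror1 vC => boxC I
  | OnMirror2 vH => boxH I
  | OnMirror2 vJ => boxJ I
  | Free vB => boxB I
  | Free vD => boxD I
  | Free vE => boxE I
  | Free vF => boxF I
  | Free vG => boxG I
  | Free vB1 => isubdivide (boxB I) (boxE I) (fraction_itv 1 2)
  | Free vC1 => isubdivide (boxC I) (boxD I) (fraction_itv 1 3)
  | Free vC2 => isubdivide (boxC I) (boxD I) (fraction_itv 2 3)
  | Free vDG => isubdivide (boxD I) (boxG I) (fraction_itv 1 2)
  | Free vDH => isubdivide (boxD I) (boxH I) (fraction_itv 1 2)
  | Free vGH => isubdivide (boxG I) (boxH I) (fraction_itv 1 2)
  end.

Lemma memp_quarter_box (I : itv) (T : R) (q : quarter_vertex) :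
  boxes_ok I = true -> mem I T ->
  memp (quarter_box I q) (quarter_position (harborth T) q).
Proof.
intros H HT; destruct (enclp_points I H) as [(A & B & C & D & E & F & G & HH & J) _].
assert (M : forall P K, enclp I P K -> memp K (P T))
  by (intros P K [K1 K2]; split; [now apply K1 | now apply K2]).
destruct q as [x | x | x]; destruct x; cbn [quarter_box quarter_position harborth
  pA pB pC pD pE pF pG pH pJ];
  lazymatch goal with
  | |- memp (isubdivide _ _ _) _ =>
      apply memp_isubdivide; [| | now apply mem_fraction_itv]
  | _ => idtac
  end;
  match goal with K : enclp I ?P _ |- memp _ (?P T) => exact (M _ _ K) end.
Qed.

(* Tabulation makes the kernel compute every box once. *)
Definition root_box : quarter_vertex -> box := Eval vm_compute in fun q =>
  match q with
  | OnMirror1 vA => quarter_box root_itv (OnMirror1 vA)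
  | OnMirror1 vC => quarter_box root_itv (OnMirror1 vC)
  | OnMirror2 vH => quarter_box root_itv (OnMirror2 vH)
  | OnMirror2 vJ => quarter_box root_itv (OnMirror2 vJ)
  | Free vB => quarter_box root_itv (Free vB)
  | Free vD => quarter_box root_itv (Free vD)
  | Free vE => quarter_box root_itv (Free vE)
  | Free vF => quarter_box root_itv (Free vF)
  | Free vG => quarter_box root_itv (Free vG)
  | Free vB1 => quarter_box root_itv (Free vB1)
  | Free vC1 => quarter_box root_itv (Free vC1)
  | Free vC2 => quarter_box root_itv (Free vC2)
  | Free vDG => quarter_box root_itv (Free vDG)
  | Free vDH => quarter_box root_itv (Free vDH)
  | Free vGH => quarter_box root_itv (Free vGH)
  end.

Lemma root_boxE (q : quarter_vertex) : root_box q = quarter_box root_itv q.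
Proof. destruct q as [x | x | x]; destruct x; vm_compute; reflexivity. Qed.

Lemma root_boxes_ok : boxes_ok root_itv = true.
Proof. vm_compute; reflexivity. Qed.

Lemma root_drawing_ok : drawing_ok root_box = true.
Proof. vm_compute; reflexivity. Qed.

(** * Reflections in the two lines and the completed graph at the root *)

Lemma reflect_vertical (h y1 y2 : R) (P : point) :
  y1 <> y2 -> reflect (h, y1) (h, y2) P = mirror h false true P.
Proof.
intros H; unfold reflect, mirror, dot, vec; cbn [fst snd]; f_equal; field;
  intros E; apply H; nra.
Qed.

Lemma reflect_x_axis (c : R) (P : point) :
  c <> 0 -> reflect (0, 0) (c, 0) P = mirror 0 true false P.
Proof.
intros H; unfold reflect, mirror, dot, vec; cbn [fst snd]; f_equal; field;
  intros E; apply H; nra.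
Qed.

Section Root.

Variable T : R.
Hypothesis root_mem : mem root_itv T.
Hypothesis root_offset : offset T = 0.

Let c := harborth T.
Let h := fst (pH c).

Lemma root_bounds : 0.12 < T < 0.13.
Proof.
assert (S : IZR scale = 1000000000) by reflexivity.
unfold mem in root_mem; rewrite S in root_mem.
cbn [fst snd root_itv] in root_mem; unfold root_lo, root_hi in root_mem; lra.
Qed.

Lemma root_memp (q : quarter_vertex) : memp (root_box q) (quarter_position c q).
Proof. rewrite root_boxE; now apply memp_quarter_box; [apply root_boxes_ok|]. Qed.

Lemma root_configuration : is_harborth_configuration T c.
Proof.
destruct (enclp_points _ root_boxes_ok) as [_ K].
destruct (K T root_mem) as [K1 K2]; assert (B := root_bounds).
apply harborth_is_configuration; [lra | | assumption | lra].
rewrite sqdist_AE by lra.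
assert (S := sqrt3_bounds); assert (L := leg_nonneg T).
assert (L2 := leg_sqr T ltac:(lra)).
assert (L1 : leg T <= 1) by nra.
assert (sqrt 3 * T <= 1.8 * 0.13) by nra.
(* The margin is narrow: the bounds on [T] and [sqrt 3 * T] together with [leg T <= 1] would only
   give 4.0036, and [L2] closes the gap. *)
nra.
Qed.

Lemma root_drawing : planar_unit_distance_drawing quarter_edges (quarter_position c).
Proof.
apply (drawing_ok_spec root_box); [apply root_memp | apply root_drawing_ok |].
intros x y; exact (quarter_edge_length T c x y root_configuration).
Qed.

Lemma root_pos_snd (q : quarter_vertex) :
  ipos (snd (root_box q)) = true -> 0 < snd (quarter_position c q).
Proof. intros H; exact (ipos_spec _ _ H (proj2 (root_memp q))). Qed.

Lemma root_pos_fst (q : quarter_vertex) :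
  ipos (isub (fst (root_box q)) (fst (root_box (OnMirror2 vH)))) = true ->
  h < fst (quarter_position c q).
Proof.
intros H; assert (K := ipos_spec _ _ H
  (mem_isub _ _ _ _ (proj1 (root_memp q)) (proj1 (root_memp (OnMirror2 vH))))).
cbn [quarter_position] in K; fold h in K; lra.
Qed.

(** That [J] lies strictly below [H] makes the line [HJ] well defined and the angle [PI / 2] rather
    than its opposite. *)
Lemma root_J : fst (pJ c) = h /\ snd (pJ c) < snd (pH c).
Proof.
split.
- revert root_offset; unfold offset, h, c; cbn [harborth pH pJ]; lra.
- apply (below_spec (root_box (OnMirror2 vJ)) (root_box (OnMirror2 vH)));
    [apply (root_memp (OnMirror2 vJ)) | apply (root_memp (OnMirror2 vH)) |].
  vm_compute; reflexivity.
Qed.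

Lemma root_mirror1 (x : mirror1_vertex) :
  snd (quarter_position c (OnMirror1 x)) = 0 /\ h < fst (quarter_position c (OnMirror1 x)).
Proof.
split; [destruct x; reflexivity|].
apply root_pos_fst; destruct x; vm_compute; reflexivity.
Qed.

Lemma root_mirror2 (x : mirror2_vertex) :
  fst (quarter_position c (OnMirror2 x)) = h /\ 0 < snd (quarter_position c (OnMirror2 x)).
Proof.
split; [destruct x; [reflexivity | apply root_J]|].
apply root_pos_snd; destruct x; vm_compute; reflexivity.
Qed.

Lemma root_free (x : free_vertex) :
  h < fst (quarter_position c (Free x)) /\ 0 < snd (quarter_position c (Free x)).
Proof.
split; [apply root_pos_fst | apply root_pos_snd];
  destruct x; vm_compute; reflexivity.
Qed.

Lemma root_completes : completes_to_harborth_graph c.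
Proof.
exists (glued h (quarter_position c)); split;
  [|exact (glued_drawing _ _ root_mirror1 root_mirror2 root_free root_drawing)].
intros r1 r2 q; cbv zeta.
assert (C0 : 2 * leg T <> 0).
{ assert (B := root_bounds); assert (L := leg_sqr T ltac:(lra)); nra. }
destruct root_J as [J1 J2].
rewrite (surjective_pairing (pH c)), (surjective_pairing (pJ c)), J1; fold h.
change (pA c) with (0, 0); change (pC c) with (2 * leg T, 0).
rewrite reflect_vertical by lra.
replace (glued h (quarter_position c) (copy r1 r2 q))
  with (mirror h r1 r2 (quarter_position c q)).
- destruct r1; [rewrite reflect_x_axis by assumption|]; destruct r2;
    destruct (quarter_position c q); reflexivity.
- symmetry; apply (glued_copy _ _ root_mirror1 root_mirror2).
Qed.

End Root.

Theorem mainTheorem1 :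
  exists b : R,
    largest_parameter b /\ 0.13504 <= b < 0.13505 /\
    exists (T : R) (c : configuration),
      0 <= T <= b /\
      is_harborth_configuration T c /\
      polar_angle (vec (pJ c) (pH c)) (PI / 2) /\
      dot (vec (pJ c) (pH c)) (vec (pA c) (pC c)) = 0 /\
      completes_to_harborth_graph c.
Proof.
destruct max_parameter_sqr as [_ B].
exists max_parameter; split; [apply largest_max_parameter|]; split; [exact B|].
destruct offset_root as (T & HT & HR); exists T, (harborth T).
assert (BT := root_bounds T HT); destruct (root_J T HT HR) as [J1 J2].
split; [lra|]; split; [exact (root_configuration T HT)|].
split; [|split; [|exact (root_completes T HT HR)]].
- split; [assert (P := PI_RGT_0); lra|].
  exists (snd (pH (harborth T)) - snd (pJ (harborth T))); split; [lra|].
  rewrite cos_PI2, sin_PI2; unfold vec; f_equal; lra.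
- unfold dot, vec; rewrite J1; cbn [fst snd pA pC harborth ptA ptC]; ring.
Qed.
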